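(* Let $r$ be continuous, let $f$ be a nontrivial real solution of $f''(x)+r(x)f(x)=0$, let $z_{f'_1}<z_{f'_2}$ be two consecutive zeros of $f'$, let $\mathcal{I}=(z_{f'_1},z_{f'_2})$, and let $z_{f_1}$ be the unique zero of $f$ in $\mathcal{I}$. Put $h=f/f'$ on $\mathcal I$. Suppose $r$ is positive and non-increasing in $\mathcal{I}$. Let $x_0,y_0\in\mathcal I$ with $x_0<z_{f_1}<y_0$, and let $(x_n)$, $(y_n)$ be the sequences generated by $$x_{n+1}=x_n-\frac{2h(x_n)}{2+r(x_0)h^2(x_n)},\qquad y_{n+1}=y_n-\frac{2h(y_n)}{2+r(x_0)h^2(y_n)},\qquad n=0,1,2,\dots$$ (the constant $r(x_0)$ is used in both recursions). Then $(x_n)$ and $(y_n)$ converge monotonically to $z_{f_1}$ and, for every $n$, $$x_0<x_1<x_2<\cdots<x_n<z_{f_1}<y_n<\cdots<y_2<y_1<y_0.$$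
   Context: All functions are real-valued; $r$ is continuous on an open interval $D\subseteq\mathbb{R}$ containing all points mentioned, and $f$ is a not identically zero solution on $D$ of $f''+rf=0$. It is a standing assumption that $f$ has exactly one zero $z_{f_1}$ in $\mathcal I=(z_{f'_1},z_{f'_2})$. Since $f'$ has no zeros in $\mathcal I$, the function $h=f/f'$ is defined on $\mathcal I$. ''Converges monotonically'' means that the sequence is monotone and converges. *)

(* Defs.v *)
From Stdlib Require Import Reals.
From Coquelicot Require Import Coquelicot.
Open Scope R_scope.

(* The endpoints may be infinite. *)
Definition open_Rbar_interval (A B : Rbar) (x : R) : Prop :=
  Rbar_lt A (Finite x) /\ Rbar_lt (Finite x) B.

(* [Derive] is total, so both derivatives are required to exist. *)
Definition solves_ode (r f : R -> R) (D : R -> Prop) : Prop :=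
  forall x : R, D x ->
    ex_derive f x /\ ex_derive (Derive f) x /\
    Derive (Derive f) x + r x * f x = 0.

Definition nontrivial_on (f : R -> R) (D : R -> Prop) : Prop :=
  exists x : R, D x /\ f x <> 0.

Definition consecutive_zeros (g : R -> R) (a b : R) : Prop :=
  a < b /\ g a = 0 /\ g b = 0 /\ forall x : R, a < x < b -> g x <> 0.

Definition unique_zero_in (g : R -> R) (I : R -> Prop) (z : R) : Prop :=
  I z /\ g z = 0 /\ forall w : R, I w -> g w = 0 -> w = z.

Definition positive_on (g : R -> R) (I : R -> Prop) : Prop :=
  forall x : R, I x -> 0 < g x.

Definition non_increasing_on (g : R -> R) (I : R -> Prop) : Prop :=
  forall x y : R, I x -> I y -> x <= y -> g y <= g x.

(* Meaningful only where [Derive f] does not vanish. *)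
Definition ratio (f : R -> R) (x : R) : R := f x / Derive f x.

Definition step (h : R -> R) (c x : R) : R :=
  x - 2 * h x / (2 + c * (h x) ^ 2).

Definition converges_monotonically (u : nat -> R) (l : R) : Prop :=
  (Un_growing u \/ Un_decreasing u) /\ is_lim_seq u (Finite l).

(* Main.v *)
(* The function h = f / f' satisfies the Riccati equation h' = 1 + r h^2, so it
   is strictly increasing and has the sign of t - z.  With c = r(x0) >= r on
   [x0, b), the map S(t) = t - 2 h / (2 + c h^2) has derivative
   1 - 2 h' (2 - c h^2) / (2 + c h^2)^2, which is positive wherever h <> 0
   because h' <= 1 + c h^2.  Hence S is strictly increasing on [x0, b) and fixes z, so
   its iterates stay on one side of z, move towards z, and their limit is a
   zero of h. *)
Require Import Defs.
From Stdlib Require Import Reals Lra.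
From Coquelicot Require Import Coquelicot.
Open Scope R_scope.

(** Quotient rule, with the second derivative replaced by [- r t * f t] from the equation. *)
Lemma is_derive_ratio (r f : R -> R) (D : R -> Prop) (t : R) :
  solves_ode r f D -> D t -> Derive f t <> 0 ->
  is_derive (ratio f) t (1 + r t * ratio f t ^ 2).
Proof.
intros Hsol Ht Hnz.
destruct (Hsol t Ht) as [Hf [Hdf Hode]].
unfold ratio.
evar_last.
- apply is_derive_div; [apply Derive_correct; exact Hf | apply Derive_correct; exact Hdf | exact Hnz].
- replace (Derive (Derive f) t) with (- (r t * f t)) by lra.
  unfold minus, plus, opp, mult, scal; simpl.
  field; exact Hnz.
Qed.

Lemma is_derive_step (h : R -> R) (c t dh : R) :
  0 <= c -> is_derive h t dh ->
  is_derive (step h c) t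
    (1 - 2 * dh * (2 - c * h t ^ 2) / (2 + c * h t ^ 2) ^ 2).
Proof.
intros Hc Hh.
assert (Hden : 2 + c * h t ^ 2 <> 0) by nra.
unfold step.
auto_derive.
- split; [now exists dh | split; [now exists dh | split; [exact Hden | exact I]]].
- replace (Derive (fun x => h x) t) with dh
    by (symmetry; apply is_derive_unique; exact Hh).
  field; exact Hden.
Qed.

(** Here [q] and [H] stand for [r t] and [h t]. At [H = 0] the expression is 0, so the strict sign
    holds only away from the zero of [h]. *)
Lemma step_derivative_pos (c q H : R) :
  0 < c -> 0 < q <= c -> H <> 0 ->
  0 < 1 - 2 * (1 + q * H ^ 2) * (2 - c * H ^ 2) / (2 + c * H ^ 2) ^ 2.
Proof.
intros Hc [Hq Hqc] HH.
assert (Hsq : 0 < H ^ 2) by (apply pow2_gt_0; exact HH).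
set (K := H ^ 2) in *.
assert (HcK : 0 < c * K) by (apply Rmult_lt_0_compat; assumption).
assert (HqK : 0 < q * K) by (apply Rmult_lt_0_compat; assumption).
assert (Hle : q * K <= c * K) by (apply Rmult_le_compat_r; lra).
replace (1 - 2 * (1 + q * K) * (2 - c * K) / (2 + c * K) ^ 2)
  with (((2 + c * K) ^ 2 - 2 * (1 + q * K) * (2 - c * K)) / (2 + c * K) ^ 2)
  by (field; lra).
apply Rdiv_lt_0_compat; [| apply pow_lt; lra].
(* With s = c K: if s <= 2, replacing q K by s leaves a numerator of at least 2 s + 3 s^2; if s > 2,
   the subtracted product is negative. *)
destruct (Rle_dec (c * K) 2); nra.
Qed.

(** Mean value theorem. Positivity is asked only in the interior because the derivative of [step]
    vanishes at [z], later an endpoint. *)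
Lemma is_derive_pos_lt (g dg : R -> R) (u v : R) :
  u < v ->
  (forall t, u <= t <= v -> is_derive g t (dg t)) ->
  (forall t, u < t < v -> 0 < dg t) ->
  g u < g v.
Proof.
intros Huv Hd Hpos.
destruct (MVT_cor2 g dg u v Huv) as [t [Heq Ht]].
- intros t Ht; apply is_derive_Reals; apply Hd; exact Ht.
- specialize (Hpos t Ht); nra.
Qed.

Lemma step_increasing (h r : R -> R) (c u v : R) :
  0 < c -> u < v ->
  (forall t, u <= t <= v -> is_derive h t (1 + r t * h t ^ 2)) ->
  (forall t, u < t < v -> 0 < r t <= c /\ h t <> 0) ->
  step h c u < step h c v.
Proof.
intros Hc Huv Hd Hr.
apply (is_derive_pos_lt (step h c)
  (fun t => 1 - 2 * (1 + r t * h t ^ 2) * (2 - c * h t ^ 2)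
                / (2 + c * h t ^ 2) ^ 2)); [exact Huv | |].
- intros t Ht; apply is_derive_step; [lra | apply Hd; exact Ht].
- intros t Ht; destruct (Hr t Ht); now apply step_derivative_pos.
Qed.

Lemma step_fixed (h : R -> R) (c t : R) : h t = 0 -> step h c t = t.
Proof. intros Ht; unfold step; rewrite Ht; field; lra. Qed.

Lemma step_fixed_inv (h : R -> R) (c t : R) :
  0 <= c -> step h c t = t -> h t = 0.
Proof.
unfold step; intros Hc Heq.
assert (Hden : 0 < 2 + c * h t ^ 2) by nra.
assert (H0 : 2 * h t / (2 + c * h t ^ 2) = 0) by lra.
apply Rmult_integral in H0; destruct H0 as [H0 | H0]; [lra |].
now apply Rinv_neq_0_compat in H0; [| lra].
Qed.

Lemma step_gt (h : R -> R) (c t : R) : 0 <= c -> h t < 0 -> t < step h c t.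
Proof.
unfold step; intros Hc Ht.
assert (0 < - (2 * h t) / (2 + c * h t ^ 2)) by (apply Rdiv_lt_0_compat; nra).
unfold Rdiv in *; lra.
Qed.

Lemma step_lt (h : R -> R) (c t : R) : 0 <= c -> 0 < h t -> step h c t < t.
Proof.
unfold step; intros Hc Ht.
assert (0 < 2 * h t / (2 + c * h t ^ 2)) by (apply Rdiv_lt_0_compat; nra).
lra.
Qed.

(** Differentiability of [h] at [l] makes [step h c] continuous there, so the recurrence passes to
    the limit and [l] is a fixed point. *)
Lemma step_limit_zero (h : R -> R) (c l dh : R) (u : nat -> R) :
  0 <= c -> is_derive h l dh ->
  (forall n, u (S n) = step h c (u n)) ->
  is_lim_seq u l -> h l = 0.
Proof.
intros Hc Hd Hrec Hlim.
apply (step_fixed_inv h c); [exact Hc |].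
assert (Hcont : is_lim_seq (fun n => step h c (u n)) (step h c l)).
{ apply is_lim_seq_continuous; [| exact Hlim].
  apply continuity_pt_filterlim, (ex_derive_continuous (step h c) l).
  eexists; apply is_derive_step; [exact Hc | exact Hd]. }
apply is_lim_seq_incr_1 in Hlim.
apply (is_lim_seq_ext _ _ _ Hrec), is_lim_seq_unique in Hlim.
apply is_lim_seq_unique in Hcont.
rewrite Hcont in Hlim; now injection Hlim.
Qed.

Theorem theorem3p3
  (A B : Rbar) (r f : R -> R) (a b z x0 y0 : R) (x y : nat -> R)
  (r_cont : forall t : R, open_Rbar_interval A B t -> continuous r t)
  (f_sol : solves_ode r f (open_Rbar_interval A B))
  (f_nontriv : nontrivial_on f (open_Rbar_interval A B))
  (a_in : open_Rbar_interval A B a)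
  (b_in : open_Rbar_interval A B b)
  (ab_cons : consecutive_zeros (Derive f) a b)
  (z_zero : unique_zero_in f (open_interval a b) z)
  (r_pos : positive_on r (open_interval a b))
  (r_noninc : non_increasing_on r (open_interval a b))
  (x0_in : open_interval a b x0)
  (y0_in : open_interval a b y0)
  (x0_lt_z : x0 < z)
  (z_lt_y0 : z < y0)
  (x_init : x 0%nat = x0)
  (y_init : y 0%nat = y0)
  (x_rec : forall n : nat, x (S n) = step (ratio f) (r x0) (x n))
  (y_rec : forall n : nat, y (S n) = step (ratio f) (r x0) (y n)) :
  converges_monotonically x z /\
  converges_monotonically y z /\
  forall n : nat,
    (forall k : nat, (k < n)%nat -> x k < x (S k)) /\
    x n < z /\
    z < y n /\
    (forall k : nat, (k < n)%nat -> y (S k) < y k).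
Proof.
destruct ab_cons as [_ [_ [_ Hdf]]].
destruct z_zero as [Hz [Hfz Huniq]].
unfold open_interval in *.
set (h := ratio f) in *; set (c := r x0) in *.
assert (Hc : 0 < c) by (apply r_pos; exact x0_in).
assert (Hhz : h z = 0) by (unfold h, ratio; rewrite Hfz; apply Rmult_0_l).
assert (Hd : forall t, a < t < b -> is_derive h t (1 + r t * h t ^ 2)).
{ intros t Ht.
  apply (is_derive_ratio _ _ _ _ f_sol); [| apply Hdf; exact Ht].
  split.
  - apply Rbar_lt_trans with a; [apply a_in | apply Ht].
  - apply Rbar_lt_trans with b; [apply Ht | apply b_in]. }
(* Monotonicity of [r] bounds it by [c = r x0] only to the right of [x0]; both sequences must
   therefore stay there. *)
assert (Hr : forall t, x0 <= t < b -> 0 < r t <= c).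
{ intros t Ht; split; [apply r_pos | apply r_noninc]; lra. }
assert (Hincr : forall u v, a < u -> u < v -> v < b -> h u < h v).
{ intros u v Hu Huv Hv.
  apply (is_derive_pos_lt h (fun t => 1 + r t * h t ^ 2)); [exact Huv | |].
  - intros t Ht; apply Hd; lra.
  - intros t Ht; assert (0 < r t) by (apply r_pos; lra).
    pose proof (pow2_ge_0 (h t)); nra. }
assert (Hneg : forall t, a < t -> t < z -> h t < 0).
{ intros t Ht Htz; rewrite <- Hhz; apply Hincr; lra. }
assert (Hpos : forall t, z < t -> t < b -> 0 < h t).
{ intros t Ht Htb; rewrite <- Hhz; apply Hincr; lra. }
assert (Hzero : forall t, a < t < b -> h t = 0 -> t = z).
{ intros t Ht H0; destruct (Rtotal_order t z) as [Hl | [He | Hg]].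
  - specialize (Hneg t); lra.
  - exact He.
  - specialize (Hpos t); lra. }
(* The lower bound [x0] is carried along so that [Hr] applies between [x n] and [z]. *)
assert (Hx : forall n, x0 <= x n < z).
{ induction n as [| n IH]; [lra |].
  rewrite x_rec; split.
  - apply Rle_trans with (x n); [lra |].
    apply Rlt_le, step_gt; [lra | apply Hneg; lra].
  (* Writing [z] as its own image turns the bound into monotonicity of [step] on [[x n], [z]]. *)
  - rewrite <- (step_fixed h c z Hhz).
    apply (step_increasing h r); [exact Hc | lra | |].
    + intros t Ht; apply Hd; lra.
    + intros t Ht; split; [apply Hr; lra |].
      apply Rlt_not_eq, Hneg; lra. }
(* The upper bound [y0] keeps the iterates away from [b]. *)
assert (Hy : forall n, z < y n <= y0).
{ induction n as [| n IH]; [lra |].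
  rewrite y_rec; split.
  - rewrite <- (step_fixed h c z Hhz).
    apply (step_increasing h r); [exact Hc | lra | |].
    + intros t Ht; apply Hd; lra.
    + intros t Ht; split; [apply Hr; lra |].
      apply Rgt_not_eq, Hpos; lra.
  - apply Rle_trans with (y n); [| lra].
    apply Rlt_le, step_lt; [lra | apply Hpos; lra]. }
assert (Hxs : forall n, x n < x (S n)).
{ intros n; rewrite x_rec; apply step_gt; [lra |].
  specialize (Hx n); apply Hneg; lra. }
assert (Hys : forall n, y (S n) < y n).
{ intros n; rewrite y_rec; apply step_lt; [lra |].
  specialize (Hy n); apply Hpos; lra. }
(* Closed bounds survive the limit, so it lies inside ([a], [b]), where [h] is differentiable and
   [z] is its only zero. *)
assert (Hlim : forall u, (forall n, x0 <= u n <= y0) ->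
  (forall n, u (S n) = step h c (u n)) ->
  ex_finite_lim_seq u -> is_lim_seq u z).
{ intros u Hu Hrec [l Hl].
  assert (Hl0 : x0 <= l).
  { apply (is_lim_seq_le (fun _ => x0) u x0 l);
      [apply Hu | apply is_lim_seq_const | exact Hl]. }
  assert (Hl1 : l <= y0).
  { apply (is_lim_seq_le u (fun _ => y0) l y0);
      [apply Hu | exact Hl | apply is_lim_seq_const]. }
  rewrite <- (Hzero l); [exact Hl | lra |].
  apply (step_limit_zero h c l (1 + r l * h l ^ 2) u);
    [lra | apply Hd; lra | exact Hrec | exact Hl]. }
split; [| split].
- split; [left; intros n; apply Rlt_le, Hxs |].
  apply Hlim; [| exact x_rec |].
  + intros n; specialize (Hx n); lra.
  (* Existence of the limit: an increasing sequence bounded above by [z]. *)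
  + apply (ex_finite_lim_seq_incr x z);
      intros n; apply Rlt_le; [apply Hxs | apply Hx].
- split; [right; intros n; apply Rlt_le, Hys |].
  apply Hlim; [| exact y_rec |].
  + intros n; specialize (Hy n); lra.
  + apply (ex_finite_lim_seq_decr y z);
      intros n; apply Rlt_le; [apply Hys | apply Hy].
- intros n; repeat split.
  + intros k _; apply Hxs.
  + apply Hx.
  + apply Hy.
  + intros k _; apply Hys.
Qed.
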